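(* Let $d_1,d_2$ be positive integers. For every integer $n\ge 0$: (i) $\dim (\mathcal{I}_{d_1,d_2})_n=\omega_n(d_1,d_2;0)-\omega_n(d_1,d_2;2)$; (ii) $\dim (\mathcal{S}_{d_1,d_2})_n=\omega_n(d_1,d_2;0)+\omega_n(d_1,d_2;1)$.
   Context: All vector spaces are over $\mathbb{C}$. $V_d=\langle v_0,\dots,v_d\rangle$ is the $(d+1)$-dimensional irreducible $\mathfrak{sl}_2$-module, on which the standard basis elements $\begin{pmatrix}0&1\\0&0\end{pmatrix},\begin{pmatrix}0&0\\1&0\end{pmatrix},\begin{pmatrix}1&0\\0&-1\end{pmatrix}$ act by $D_1(v_i)=i\,v_{i-1}$, $D_2(v_i)=(d-i)v_{i+1}$, $E(v_i)=(d-2i)v_i$. The action is extended by derivations to the symmetric algebra $S(V_{d_1}\oplus V_{d_2})=\bigoplus_n S^n(V_{d_1}\oplus V_{d_2})$. The algebra of joint invariants is $\mathcal{I}_{d_1,d_2}=\{v\in S(V_{d_1}\oplus V_{d_2}) : D_1(v)=0,\ D_2(v)=0\}$ and the algebra of joint semi-invariants (isomorphic to the algebra of joint covariants) is $\mathcal{S}_{d_1,d_2}=\{v\in S(V_{d_1}\oplus V_{d_2}) : D_1(v)=0\}$. The subscript $n$ denotes the degree-$n$ homogeneous component, i.e. the intersection with $S^n(V_{d_1}\oplus V_{d_2})$. $\omega_n(d_1,d_2;i)$ is the number of solutions in nonnegative integers $\alpha_0,\dots,\alpha_{d_1},\beta_0,\dots,\beta_{d_2}$ of the system $$d_1|\alpha|+d_2|\beta|-(\alpha_1+2\alpha_2+\cdots+d_1\alpha_{d_1})\cdot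 2-(\beta_1+2\beta_2+\cdots+d_2\beta_{d_2})\cdot 2=i,\qquad |\alpha|+|\beta|=n,$$ where $|\alpha|=\sum_j\alpha_j$, $|\beta|=\sum_j\beta_j$; equivalently $\sum_{j=0}^{d_1}(d_1-2j)\alpha_j+\sum_{j=0}^{d_2}(d_2-2j)\beta_j=i$ and $|\alpha|+|\beta|=n$. *)

(* Defs.v *)
From HB Require Import structures.
From mathcomp Require Import all_boot all_order all_algebra.
From mathcomp Require Import reals complex.
From mathcomp Require Import mpoly.

Set Implicit Arguments.
Unset Strict Implicit.
Unset Printing Implicit Defensive.

Import GRing.Theory.
Local Open Scope ring_scope.

(* The complex numbers are R[i] for R : realType.  S(V_d1 (+) V_d2) is the
   polynomial algebra on the d1.+1 basis vectors of V_d1 (the variables of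
   index lshift _ i) followed by the d2.+1 basis vectors of V_d2 (the variables
   of index rshift _ j). *)
Notation nvars d1 d2 := (d1.+1 + d2.+1)%N.

Section Derivations.
Context {R : realType} {d1 d2 : nat}.
Local Notation C := R[i].
Local Notation S := {mpoly C[nvars d1 d2]}.
Implicit Types (p q : S) (f : 'I_(nvars d1 d2) -> S).

Definition basis1 (i : 'I_d1.+1) : S := 'X_(lshift d2.+1 i).
Definition basis2 (j : 'I_d2.+1) : S := 'X_(rshift d1.+1 j).

(* The action on the basis v of V_d, with values in S.  The out-of-range
   vectors v_(-1) and v_(d+1) come with coefficient 0, so that the junk value
   of their index is harmless. *)
Definition raise (d : nat) (v : 'I_d.+1 -> S) (i : 'I_d.+1) : S :=
  i%:R *: v (inord i.-1).
Definition lower (d : nat) (v : 'I_d.+1 -> S) (i : 'I_d.+1) : S :=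
  (d - i)%:R *: v (inord i.+1).

Definition on_basis (u1 : 'I_d1.+1 -> S) (u2 : 'I_d2.+1 -> S)
    (k : 'I_(nvars d1 d2)) : S :=
  match split k with inl i => u1 i | inr j => u2 j end.

(* The unique C-linear derivation of S mapping the variable k to f k. *)
Definition derivation_of f p : S := \sum_k f k * p^`M(k).

Definition D1 : S -> S := derivation_of (on_basis (raise basis1) (raise basis2)).
Definition D2 : S -> S := derivation_of (on_basis (lower basis1) (lower basis2)).

Lemma derivation_of_is_linear f : linear (derivation_of f).
Proof.
move=> c p q; rewrite /derivation_of scaler_sumr -big_split /=.
by apply: eq_bigr => k _; rewrite linearP mulrDr scalerAr.
Qed.

HB.instance Definition _ f :=
  GRing.isLinear.Build _ _ _ _ (derivation_of f) (derivation_of_is_linear f).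

Lemma derivation_ofM f p q :
  derivation_of f (p * q) = derivation_of f p * q + p * derivation_of f q.
Proof.
rewrite /derivation_of mulr_suml mulr_sumr -big_split /=.
by apply: eq_bigr => k _; rewrite mderivM mulrDr !mulrA [p * f k]mulrC.
Qed.

Lemma derivation_ofX f k : derivation_of f 'X_k = f k.
Proof.
rewrite /derivation_of (bigD1 k) //= big1 => [|l neq_lk].
  by rewrite mderivX mnmE eqxx scale1r -[X in (X - _)%MM]add0m addmK mpolyX0 mulr1 addr0.
by rewrite mderivX mnmE eq_sym (negPf neq_lk) scale0r mulr0.
Qed.

Lemma D1_basis1 i : D1 (basis1 i) = i%:R *: basis1 (inord i.-1).
Proof. by rewrite /D1 derivation_ofX /on_basis (unsplitK (inl i)). Qed.

Lemma D1_basis2 j : D1 (basis2 j) = j%:R *: basis2 (inord j.-1).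
Proof. by rewrite /D1 derivation_ofX /on_basis (unsplitK (inr j)). Qed.

Lemma D2_basis1 i : D2 (basis1 i) = (d1 - i)%:R *: basis1 (inord i.+1).
Proof. by rewrite /D2 derivation_ofX /on_basis (unsplitK (inl i)). Qed.

Lemma D2_basis2 j : D2 (basis2 j) = (d2 - j)%:R *: basis2 (inord j.+1).
Proof. by rewrite /D2 derivation_ofX /on_basis (unsplitK (inr j)). Qed.

Lemma derivation_of_homog f n p :
  (forall k, f k \is 1.-homog) -> p \is n.-homog ->
  derivation_of f p \is n.-homog.
Proof.
move=> hf hp; rewrite (mpolyE p) big_seq linear_sum.
apply: rpred_sum => m /(dhomog_mf hp) hm; rewrite linearZ rpredZ //.
apply: rpred_sum => k _; rewrite mderivX -scalerAr.
have [->|mk0] := eqVneq (m k) 0%N; first by rewrite scale0r rpred0.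
have le_km : (U_(k) <= m)%MM.
  by apply/mnm_lepP => l; rewrite mnmE; case: eqP => // <-; rewrite lt0n.
have -> : n = (1 + mdeg (m - U_(k))%MM)%N.
  by rewrite -hm -{1}(submK le_km) /= mdegD mdeg1 addnC.
by rewrite rpredZ // dhomogM // dhomogX.
Qed.

Lemma on_basis_homog (u1 : 'I_d1.+1 -> S) (u2 : 'I_d2.+1 -> S) :
  (forall i, u1 i \is 1.-homog) -> (forall j, u2 j \is 1.-homog) ->
  forall k, on_basis u1 u2 k \is 1.-homog.
Proof. by move=> h1 h2 k; rewrite /on_basis; case: split. Qed.

Lemma D1_homog n p : p \is n.-homog -> D1 p \is n.-homog.
Proof.
by apply/derivation_of_homog/on_basis_homog => i;
  apply: rpredZ; rewrite dhomogX /= mdeg1.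
Qed.

Lemma D2_homog n p : p \is n.-homog -> D2 p \is n.-homog.
Proof.
by apply/derivation_of_homog/on_basis_homog => i;
  apply: rpredZ; rewrite dhomogX /= mdeg1.
Qed.

Definition joint_invariant : pred S := [pred p | (D1 p == 0) && (D2 p == 0)].
Definition joint_semi_invariant : pred S := [pred p | D1 p == 0].

End Derivations.

Section HomogeneousComponents.
Context (R : realType) (d1 d2 n : nat).
Local Notation Sn := (dhomog (nvars d1 d2) R[i] n).

Definition D1n (p : Sn) : Sn := DHomog (D1_homog (dhomog_is_dhomog p)).
Definition D2n (p : Sn) : Sn := DHomog (D2_homog (dhomog_is_dhomog p)).

Lemma D1n_is_linear : linear D1n.
Proof. by move=> c p q; apply/val_inj; apply: derivation_of_is_linear. Qed.

Lemma D2n_is_linear : linear D2n.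
Proof. by move=> c p q; apply/val_inj; apply: derivation_of_is_linear. Qed.

HB.instance Definition _ := GRing.isLinear.Build _ _ _ _ D1n D1n_is_linear.
HB.instance Definition _ := GRing.isLinear.Build _ _ _ _ D2n D2n_is_linear.

Definition joint_invariants_deg : {vspace Sn} :=
  (lker (linfun D1n) :&: lker (linfun D2n))%VS.

Definition joint_semi_invariants_deg : {vspace Sn} := lker (linfun D1n).

Lemma mem_joint_semi_invariants_deg (p : Sn) :
  (p \in joint_semi_invariants_deg) = (val p \in joint_semi_invariant).
Proof. by rewrite memv_ker lfunE. Qed.

Lemma mem_joint_invariants_deg (p : Sn) :
  (p \in joint_invariants_deg) = (val p \in joint_invariant).
Proof. by rewrite memv_cap !memv_ker !lfunE. Qed.

End HomogeneousComponents.

Definition omega_sol (n d1 d2 : nat) (i : int)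
    (a : 'I_d1.+1 -> nat) (b : 'I_d2.+1 -> nat) : bool :=
  let abs_a := (\sum_j a j)%N in
  let abs_b := (\sum_j b j)%N in
  ((d1 * abs_a)%N%:Z + (d2 * abs_b)%N%:Z
     - (\sum_(j < d1.+1) j * a j)%N%:Z * 2
     - (\sum_(j < d2.+1) j * b j)%N%:Z * 2 == i)
  && ((abs_a + abs_b)%N == n).

(* The unknowns may be taken in 'I_n.+1, see omega_sol_bounded. *)
Definition omega (n d1 d2 : nat) (i : int) : nat :=
  #|[set ab : {ffun 'I_d1.+1 -> 'I_n.+1} * {ffun 'I_d2.+1 -> 'I_n.+1} |
      omega_sol n i (fun j => ab.1 j) (fun j => ab.2 j)]|.

Lemma omega_sol_bounded n d1 d2 i
    (a : 'I_d1.+1 -> nat) (b : 'I_d2.+1 -> nat) :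
  omega_sol n i a b -> (forall j, a j < n.+1)%N /\ (forall j, b j < n.+1)%N.
Proof.
case/andP=> _ /eqP <-; split=> j; rewrite ltnS (bigD1 j) //= -?addnA ?leq_addr //.
by rewrite addnCA leq_addr.
Qed.

(* Main.v *)
Require Import Defs.
From HB Require Import structures.
From mathcomp Require Import all_boot all_order all_algebra.
From mathcomp Require Import reals complex.
From mathcomp Require Import mpoly.
From mathcomp Require Import zify ring.

Set Implicit Arguments.
Unset Strict Implicit.
Unset Printing Implicit Defensive.

Import Order.TTheory GRing.Theory Num.Theory.
Local Open Scope ring_scope.

(* The monomials of degree n form a weight basis, so [dim V_w = omega_n(d1, d2; w)]
   where [V_w] is the weight-w part of [S^n], [D1 : V_w -> V_(w+2)] and
   [D2 : V_w -> V_(w-2)].  If [D2 D1 v = 0] then [D1^k D2^k v] is a multiple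
   [k! E (E - 1) ... (E - k + 1) v]; as [D2] is nilpotent, only weights [>= 0]
   occur in [v].  Dually [D1 D2] is injective on positive weights, so [D1] maps
   [sum_(w >= 0) V_w] onto [sum_(w >= 2) V_w] and [V_0] onto [V_2].  All of
   [ker D1] lies in the former domain, whence (ii), and the invariants are the
   kernel of [D1] on [V_0], whence (i). *)

(** * Commutation identities for an $\mathfrak{sl}_2$-triple *)

Section Sl2Commutators.
Context (F : numFieldType) (V : lmodType F) (X Y E : {linear V -> V}).
Implicit Types (u v : V).
Hypothesis XY : forall v, X (Y v) - Y (X v) = E v.
Hypothesis EX : forall v, E (X v) - X (E v) = 2 *: X v.
Hypothesis EY : forall v, E (Y v) - Y (E v) = - 2 *: Y v.

Lemma iter0 (f : {linear V -> V}) k : iter k f 0 = 0.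
Proof. by elim: k => //= k ->; rewrite linear0. Qed.

Lemma iterD (f : {linear V -> V}) k u v : iter k f (u + v) = iter k f u + iter k f v.
Proof. by elim: k => //= k ->; rewrite linearD. Qed.

Lemma iterZ (f : {linear V -> V}) k a v : iter k f (a *: v) = a *: iter k f v.
Proof. by elim: k => //= k ->; rewrite linearZ. Qed.

(** Induction on [k]: moving [X] past the innermost [Y] produces a term [E v], and moving [E] past
    that [Y] costs [- 2]; the scalars add up to [k.+1] and [k]. *)
Lemma raise_iter_lower k v :
  X (iter k.+1 Y v)
  = iter k.+1 Y (X v) + k.+1%:R *: iter k Y (E v - k%:R *: v).
Proof.
elim: k v => [|k IHk] v.
  by rewrite /= scale0r subr0 scale1r -XY addrC subrK.
have EYv : E (Y v) = Y (E v) - 2 *: Y v.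
  by rewrite -scaleNr -EY addrC subrK.
rewrite iterSr IHk -[X (Y v)](subrK (Y (X v))) XY EYv.
rewrite -!scaleNr !iterD !iterZ -!iterSr !scalerDr !scalerA.
move: (iter k.+1 Y (E v)) (iter k.+2 Y (X v)) (iter k.+1 Y v) => a b c.
rewrite [a + b]addrC -!addrA -scalerDl; congr (_ + _).
rewrite addrA -{1}[a]scale1r -scalerDl.
by congr (_ *: _ + _ *: _); rewrite -[in RHS]natr1 -[X in _ = _ * - X]natr1; ring.
Qed.

(** [X] and [Y] shift weights by opposite amounts, so [Y \o X] commutes with [E] and its kernel is
    stable under every [E - a]. *)
Lemma lower_raise_shift a v :
  Y (X v) = 0 -> Y (X (E v - a *: v)) = 0.
Proof.
move=> YXv0; rewrite !linearB !linearZ /= YXv0 oppr0 scaler0 addr0.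
have -> : X (E v) = E (X v) - 2 *: X v by rewrite -EX opprB addrC subrK.
rewrite linearB !linearZ /= YXv0 oppr0 scaler0 addr0.
have -> : Y (E (X v)) = E (Y (X v)) - - 2 *: Y (X v).
  by rewrite -EY opprB addrC subrK.
by rewrite YXv0 linear0 scaler0 subr0.
Qed.

Lemma iter_lower_weight a k v :
  E v = a *: v -> E (iter k Y v) = (a - (2 * k)%:R) *: iter k Y v.
Proof.
move=> Ev; elim: k => [|k IHk]; first by rewrite muln0 subr0.
rewrite [iter _ _ _]/= -[LHS](subrK (Y (E (iter k Y v)))) EY IHk linearZ /=.
by rewrite -scalerDl mulnS natrD; congr (_ *: _); ring.
Qed.
End Sl2Commutators.

(** * Weights occurring in the kernel of [Y \o X] *)

Section LowestWeightSupport.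
Context (F : numFieldType) (V : lmodType F) (I : finType).
Context (e : I -> V) (c : I -> {scalar V}) (wt : I -> int).
Context (X Y E : {linear V -> V}).
Hypothesis ce : forall i j, c i (e j) = (i == j)%:R.
Hypothesis cK : forall v, v = \sum_i c i v *: e i.
Hypothesis cE : forall i v, c i (E v) = (wt i)%:~R * c i v.
Hypothesis XY : forall v, X (Y v) - Y (X v) = E v.
Hypothesis EX : forall v, E (X v) - X (E v) = 2 *: X v.
Hypothesis EY : forall v, E (Y v) - Y (E v) = - 2 *: Y v.

Lemma coord_inj u v : (forall i, c i u = c i v) -> u = v.
Proof.
by move=> cuv; rewrite [u]cK [v]cK; apply: eq_bigr => i _; rewrite cuv.
Qed.

Lemma weight_basis i : E (e i) = (wt i)%:~R *: e i.
Proof.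
apply: coord_inj => j; rewrite cE linearZ /= ce.
by have [->|] := eqVneq j i; rewrite ?mulr0.
Qed.

(** If [M] bounds every weight in absolute value, [iter M.+1 Y (e j)] would have weight at most
    [M - 2 * M.+1], below [- M], where no basis vector lives. *)
Lemma lower_nilpotent : exists k, forall v, iter k Y v = 0.
Proof.
pose M := (\sum_i `|wt i|)%N; have ltM i : (`|wt i| <= M)%N.
  by rewrite /M (bigD1 i) //= leq_addr.
exists M.+1 => v; rewrite [v]cK.
elim/big_rec: _ => [|j u _ IHu]; first exact: iter0.
rewrite iterD iterZ IHu addr0.
suff -> : iter M.+1 Y (e j) = 0 by rewrite scaler0.
apply: coord_inj => i; rewrite linear0.
have /(congr1 (c i)) := iter_lower_weight EY M.+1 (weight_basis j).
rewrite cE linearZ /= => /eqP; rewrite -subr_eq0 -mulrBl mulf_eq0.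
case/orP=> [|/eqP//]; rewrite -[(2 * _)%:R]/((2 * M.+1)%N%:Z%:~R) -!intrB intr_eq0.
by move: (ltM i) (ltM j); lia.
Qed.

(** Induction on [k] through [(E - k) v]: it is still killed by [Y \o X], now also by [iter k Y],
    and its [i]-th coordinate is that of [v] times [wt i - k]. Hence every weight of [v] other than
    [k] survives in it. *)
Lemma lower_raise0_weight_lt k v i :
  Y (X v) = 0 -> iter k Y v = 0 -> c i v != 0 -> (0 <= wt i < k%:Z)%R.
Proof.
elim: k v => [|k IHk] v YXv0 Ykv0 civ; first by rewrite [v]Ykv0 linear0 eqxx in civ.
have [->|wtk] := eqVneq (wt i) k%:Z; first by rewrite lez_nat leq0n ltz_nat ltnSn.
suff : (0 <= wt i < k%:Z)%R by lia.
apply: (IHk (E v - k%:R *: v)).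
- exact: lower_raise_shift EX EY _ _ YXv0.
(* Both [iter k.+1 Y v] and [iter k.+1 Y (X v)] vanish, leaving [k.+1] times the wanted vector;
   [k.+1] is invertible in characteristic 0. *)
- move: (raise_iter_lower XY EY k v).
  rewrite Ykv0 linear0 iterSr YXv0 iter0 add0r => /esym/eqP.
  by rewrite scaler_eq0 pnatr_eq0 => /eqP.
- rewrite linearB linearZ /= cE -mulrBl mulf_neq0 //.
  by rewrite -[k%:R]/(k%:Z%:~R) -intrB intr_eq0 subr_eq0.
Qed.

Lemma lower_raise0_weight_ge0 v i : Y (X v) = 0 -> c i v != 0 -> 0 <= wt i.
Proof.
have [k Yk0] := lower_nilpotent.
by move=> YXv0 /(lower_raise0_weight_lt YXv0 (Yk0 v)) /andP[].
Qed.

End LowestWeightSupport.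

(** * Dimensions of the kernels from weight multiplicities *)

Section HighestWeightCount.
Context (F : numFieldType) (V : vectType F) (I : finType).
Context (e : I -> V) (c : I -> {scalar V}) (wt : I -> int).
Context (X Y E : {linear V -> V}).
Hypothesis ce : forall i j, c i (e j) = (i == j)%:R.
Hypothesis cK : forall v, v = \sum_i c i v *: e i.
Hypothesis cE : forall i v, c i (E v) = (wt i)%:~R * c i v.
Hypothesis XY : forall v, X (Y v) - Y (X v) = E v.
Hypothesis EX : forall v, E (X v) - X (E v) = 2 *: X v.
Hypothesis EY : forall v, E (Y v) - Y (E v) = - 2 *: Y v.

(** The symmetry of $\mathfrak{sl}_2$ exchanging [X] and [Y] and negating [E] turns this into the
    bound for the kernel of [Y \o X]. *)
Lemma raise_lower0_weight_le0 v i : X (Y v) = 0 -> c i v != 0 -> wt i <= 0.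
Proof.
move=> XYv0 civ; rewrite -oppr_ge0.
apply: (@lower_raise0_weight_ge0 _ _ _ e c (fun i => - wt i) Y X (\- E)
  ce cK _ _ _ _ v i XYv0 civ) => [j u|u|u|u] /=.
- by rewrite linearN /= cE mulrNz mulNr.
- by rewrite -XY opprB.
- by rewrite linearN /= -opprD EY -scaleNr opprK.
- by rewrite linearN /= -opprD EX -scaleNr.
Qed.

(** A predicate on weights covers single weights and half-lines alike. *)
Definition weight_space (P : pred int) : {vspace V} :=
  <<[seq e i | i <- enum I & P (wt i)]>>%VS.

Lemma memv_weight_space P v :
  reflect (forall i, ~~ P (wt i) -> c i v = 0) (v \in weight_space P).
Proof.
apply: (iffP idP) => [vP i nPi|v0].
  have /(@coord_span _ _ _ (in_tuple _)) -> := vP.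
  rewrite linear_sum big1 // => j _; rewrite linearZ /=.
  have /mapP[l + ->] := mem_nth 0 (ltn_ord j).
  rewrite mem_filter ce => /andP[Pl _].
  by case: eqVneq nPi => [->|]; rewrite ?Pl ?mulr0.
rewrite [v]cK; apply: rpred_sum => i _.
have [Pi|/v0 ->] := boolP (P (wt i)); last by rewrite scale0r rpred0.
by rewrite rpredZ // memv_span // map_f // mem_filter Pi mem_enum.
Qed.

Lemma weight_basis_free : free [seq e i | i <- enum I].
Proof.
apply/(@freeP _ _ _ (codom_tuple e)) => k sum0 i.
have := congr1 (c (enum_val i)) sum0.
rewrite linear_sum linear0 (bigD1 i) //= big1 ?addr0 => [|j neq_ji].
  by rewrite linearZ /= nth_codom ce eqxx mulr1.
by rewrite linearZ /= nth_codom ce (inj_eq enum_val_inj) eq_sym (negPf neq_ji) mulr0.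
Qed.

Lemma dim_weight_space P : \dim (weight_space P) = #|[pred i | P (wt i)]|.
Proof.
have : free [seq e i | i <- enum I & P (wt i)].
  (* Completed by the remaining basis vectors, the family is a permutation of the whole basis. *)
  apply: (@catl_free _ _ [seq e i | i <- enum I & ~~ P (wt i)]).
  rewrite -map_cat (perm_free (perm_map e (permEl (perm_filterC _ _)))).
  exact: weight_basis_free.
move/eqP ->; rewrite size_map size_filter cardE enumT /enum_mem size_filter.
by apply: eq_count => i; rewrite inE.
Qed.

Lemma shift_weight_space (f : {linear V -> V}) (s : int) (P Q : pred int) :
  (forall v, E (f v) - f (E v) = s%:~R *: f v) ->
  (forall w, P w -> Q (w + s)) ->
  (linfun f @: weight_space P <= weight_space Q)%VS.
Proof.
move=> Ef PQ; rewrite limg_span; apply/span_subvP => _ /mapP[_ /mapP[j + ->] ->].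
rewrite mem_filter lfunE => /andP[Pj _]; apply/memv_weight_space => i nQi /=.
have := Ef (e j); rewrite (weight_basis ce cK cE) linearZ /=.
move/(congr1 (c i)); rewrite linearB !linearZ /= cE => /eqP.
(* The [i]-th coordinate of [f (e j)] is annihilated by [wt i - wt j - s], so it can be nonzero only
   at weight [wt j + s]. *)
rewrite -subr_eq0 -!mulrBl mulf_eq0 => /orP[|/eqP//].
rewrite -addrA -opprD -intrD -intrB intr_eq0 subr_eq0 => /eqP wtE.
by move: nQi; rewrite wtE PQ.
Qed.

(** [X \o Y] maps the [Q]-part to itself and is injective there, its kernel having only weights
    [<= 0]. The image of [X] therefore already has full dimension on the vectors coming from [Y]. *)
Lemma raise_onto_weight_space (P Q : pred int) :
  (forall w, Q w -> 0 < w) -> (forall w, P w = Q (w + 2)) ->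
  (linfun X @: weight_space P)%VS = weight_space Q.
Proof.
move=> Q0 PQ; set x := linfun X; set y := linfun Y.
have xPQ : (x @: weight_space P <= weight_space Q)%VS.
  by apply: (@shift_weight_space X 2) => // w; rewrite PQ.
have yQP : (y @: weight_space Q <= weight_space P)%VS.
  by apply: (@shift_weight_space Y (-2)) => // w; rewrite PQ subrK.
have dimQ : \dim ((x \o y) @: weight_space Q) = \dim (weight_space Q).
  apply: limg_dim_eq; apply/eqP; rewrite -subv0; apply/subvP => v.
  rewrite memv_cap memv_ker memv0 comp_lfunE !lfunE /=.
  case/andP=> /memv_weight_space vQ /eqP XYv0; apply/eqP.
  apply: (coord_inj cK) => i; rewrite linear0.
  have [/Q0 wt_gt0|/vQ//] := boolP (Q (wt i)); apply/eqP; apply: contraLR wt_gt0.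
  by rewrite -leNgt => /(raise_lower0_weight_le0 XYv0).
apply/eqP; rewrite eqEdim xPQ /= -dimQ limg_comp dimvS //.
exact: limgS.
Qed.

(** Rank-nullity for [X] on the [P]-part, whose image is the whole [Q]-part. *)
Lemma dim_raise_ker (P Q : pred int) :
  (forall w, Q w -> 0 < w) -> (forall w, P w = Q (w + 2)) ->
  (\dim (weight_space P :&: lker (linfun X)) + #|[pred i | Q (wt i)]|
   = #|[pred i | P (wt i)]|)%N.
Proof.
move=> Q0 PQ.
by rewrite -!dim_weight_space -(raise_onto_weight_space Q0 PQ) limg_ker_dim.
Qed.

(** The kernel of [X] sits in weights [>= 0], which [X] maps onto weights [>= 2]; the multiplicities
    that do not cancel are those of 0 and 1. *)
Lemma dim_highest_weight :
  \dim (lker (linfun X))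
  = (#|[pred i | wt i == 0%R]| + #|[pred i | wt i == 1%R]|)%N.
Proof.
have : (lker (linfun X) <= weight_space (fun w => (0 <= w)%R))%VS.
  apply/subvP => v; rewrite memv_ker lfunE => /eqP Xv0.
  apply/memv_weight_space => i; apply: contraNeq => civ.
  apply: (lower_raise0_weight_ge0 ce cK cE XY EX EY _ civ).
  by rewrite Xv0 linear0.
move/capv_idPr => <-.
have := @dim_raise_ker (fun w => 0 <= w) (fun w => 2 <= w).
have -> : #|[pred i | 0 <= wt i]| = (#|[pred i | wt i == 0%R]|
    + #|[pred i | wt i == 1%R]| + #|[pred i | (2 <= wt i)%R]|)%N.
  rewrite -!sum1_card.
  rewrite ![(\sum_(i in _) _)%N]big_mkcond -!big_split /=.
  by apply: eq_bigr => i _; rewrite !inE; case: (wt i) => [[|[|w]]|w].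
by move=> dimP; apply: (@addIn #|[pred i | (2 <= wt i)%R]|); apply: dimP; lia.
Qed.

(** The joint kernel equals the kernel of [X] on weight 0, and [X] maps weight 0 onto weight 2. *)
Lemma dim_invariant :
  (\dim (lker (linfun X) :&: lker (linfun Y)) + #|[pred i | wt i == 2%R]|
   = #|[pred i | wt i == 0%R]|)%N.
Proof.
rewrite -(@dim_raise_ker (pred1 0) (pred1 2)) /=; last 2 first.
- by move=> w /eqP ->.
- by move=> w; apply/eqP/eqP; lia.
congr (\dim _ + _)%N; apply/eqP; rewrite eqEsubv; apply/andP; split.
  apply/subvP => v; rewrite !memv_cap !memv_ker !lfunE.
  case/andP=> /eqP Xv0 /eqP Yv0; rewrite Xv0 eqxx andbT.
  apply/memv_weight_space => i; apply: contraNeq => civ.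
  (* [E v] is the commutator applied to [v], hence 0, so every weight of [v] is 0. *)
  have := cE i v; rewrite -XY Xv0 Yv0 (linear0 X) (linear0 Y) subrr linear0.
  move=> /esym/eqP.
  by rewrite mulf_eq0 (negPf civ) orbF intr_eq0.
apply/subvP => v; rewrite !memv_cap !memv_ker !lfunE.
case/andP=> /memv_weight_space v0 /eqP Xv0; rewrite Xv0 eqxx /=.
have Ev0 : E v = 0.
  apply: (coord_inj cK) => i; rewrite cE linear0.
  by have [->|/v0 ->] := eqVneq (wt i) 0; rewrite ?mul0r ?mulr0.
(* [Y v] lies in weight [- 2], yet being killed by [X] it has only weights [>= 0]; so it
   vanishes. *)
have XYv0 : X (Y v) = 0 by move: (XY v); rewrite Xv0 linear0 subr0 Ev0.
have Yv_le :
    (linfun Y @: weight_space (pred1 0%R) <= weight_space (pred1 (- 2)%R))%VS.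
  by apply: (@shift_weight_space Y (-2)) => // w /eqP ->.
have /memv_weight_space Yv_supp : Y v \in weight_space (pred1 (- 2)).
  have -> : Y v = linfun Y v by rewrite lfunE.
  by apply: (subvP Yv_le); apply: memv_img; apply/memv_weight_space.
apply/eqP; apply: (coord_inj cK) => i; rewrite linear0.
have [wt_i|/Yv_supp//] := boolP (pred1 (- 2) (wt i)).
apply/eqP; apply: contraTT wt_i => cYv.
have := lower_raise0_weight_ge0 ce cK cE XY EX EY _ cYv.
by rewrite XYv0 linear0 => /(_ erefl) /=; case: (wt i).
Qed.

Lemma dim_invariant_highest_weight :
  (\dim (lker (linfun X) :&: lker (linfun Y)) + #|[pred i | wt i == 2%R]|
   = #|[pred i | wt i == 0%R]|)%N
  /\ \dim (lker (linfun X))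
     = (#|[pred i | wt i == 0%R]| + #|[pred i | wt i == 1%R]|)%N.
Proof. exact: (conj dim_invariant dim_highest_weight). Qed.

End HighestWeightCount.

(** * The $\mathfrak{sl}_2$ relations on polynomials and the weights of monomials *)

Section DerivationIdentities.
Context {R : realType} {d1 d2 : nat}.
Local Notation C := R[i].
Local Notation S := {mpoly C[nvars d1 d2]}.
Implicit Types (p q : S) (f g h : 'I_(nvars d1 d2) -> S).

(** The Leibniz rule kills constants, powers of variables and then monomials; linearity does the
    rest. Operator identities thereby reduce to the variables. *)
Lemma derivation_eq0 (D : {linear S -> S}) :
  (forall p q, D (p * q) = D p * q + p * D q) ->
  (forall k, D 'X_k = 0) -> forall p, D p = 0.
Proof.
move=> DM DX; have D0 : D 0 = 0.
  by have := DM 0 0; rewrite !mulr0 mul0r addr0.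
have D1 : D 1 = 0.
  by have /eqP := DM 1 1; rewrite !mulr1 mul1r -subr_eq0 opprD addNKr oppr_eq0 => /eqP.
have DXn k j : D ('X_k ^+ j) = 0.
  by elim: j => [|j IHj]; rewrite ?expr0 // exprS DM DX IHj mul0r mulr0 addr0.
have Dm m : D 'X_[m] = 0.
  rewrite mpolyXE_id; elim/big_rec: _ => [//|k q _ Dq].
  by rewrite DM DXn Dq mul0r mulr0 addr0.
elim/mpolyind => [//|c m p _ _ IHp].
by rewrite linearP /= Dm IHp scaler0 addr0.
Qed.

Lemma derivation_ofZ a f p : derivation_of (fun k => a *: f k) p = a *: derivation_of f p.
Proof.
by rewrite scaler_sumr; apply: eq_bigr => k _; rewrite scalerAl.
Qed.

(** The mixed terms of the two Leibniz expansions cancel, so a commutator of derivations is a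
    derivation, determined by its values on variables. *)
Lemma derivation_of_commutator f g h :
  (forall k, derivation_of f (g k) - derivation_of g (f k) = h k) ->
  forall p, derivation_of f (derivation_of g p) - derivation_of g (derivation_of f p)
    = derivation_of h p.
Proof.
move=> fgh p.
have leibniz (A : comPzRingType) (u v fu fv gu gv fgu gfu fgv gfv hu hv : A) :
  fgu * v + gu * fv + (fu * gv + u * fgv) - (gfu * v + fu * gv + (gu * fv + u * gfv))
    - (hu * v + u * hv) = (fgu - gfu - hu) * v + u * (fgv - gfv - hv) by ring.
apply/eqP; rewrite -subr_eq0; apply/eqP.
pose D : {linear S -> S} :=
  ((derivation_of f \o derivation_of g) \- (derivation_of g \o derivation_of f))
  \- derivation_of h.
apply: (@derivation_eq0 D) => [{}p q|k] /=; last first.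
  by rewrite !derivation_ofX fgh subrr.
rewrite (derivation_ofM g) (derivation_ofM f p) (derivation_ofM h).
rewrite (linearD (derivation_of f)) (linearD (derivation_of g)) /=.
rewrite (derivation_ofM f _ q) (derivation_ofM f p).
rewrite (derivation_ofM g _ q) (derivation_ofM g p).
exact: leibniz.
Qed.

(** The coefficient is computed in the integers because it is negative for [i > d / 2]. *)
Definition weigh (d : nat) (v : 'I_d.+1 -> S) (i : 'I_d.+1) : S :=
  (d%:Z - 2 * i%:Z)%:~R *: v i.

Definition DE : S -> S := derivation_of (on_basis (weigh basis1) (weigh basis2)).

(** * The relations on the basis of a single $V_d$, shared by both summands *)

Section OneBlock.
Context (d : nat) (v : 'I_d.+1 -> S) (X Y E : {linear S -> S}).
Hypothesis Xv : forall i, X (v i) = raise v i.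
Hypothesis Yv : forall i, Y (v i) = lower v i.
Hypothesis Ev : forall i, E (v i) = weigh v i.

Lemma raise_lower_basis i : X (lower v i) - Y (raise v i) = weigh v i.
Proof.
rewrite (linearZ_LR X) (linearZ_LR Y) Xv Yv /raise /lower !scalerA.
(* At [i = d] the index [i.+1] is out of range and [inord] gives a default, but the factor [d - i]
   is then 0. The case [i = 0] below is handled likewise by the factor [i]. *)
have -> : ((d - i)%N%:R * (@inord d i.+1)%:R) *: v (inord (@inord d i.+1).-1)
    = ((d - i) * i.+1)%:R *: v i.
  have [lt_id|] := ltnP i d; first by rewrite inordK //= inord_val natrM.
  by rewrite -subn_eq0 => /eqP ->; rewrite mul0r mul0n !scale0r.
have -> : (i%:R * (d - @inord d i.-1)%N%:R) *: v (inord (@inord d i.-1).+1)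
    = (i * (d - i.-1))%:R *: v i.
  case: (posnP i) => [->|i_gt0]; first by rewrite mul0r mul0n !scale0r.
  have lt_id : (i.-1 < d.+1)%N by rewrite (leq_ltn_trans (leq_pred _)).
  by rewrite inordK // prednK // inord_val natrM.
rewrite -scalerBl; congr (_ *: _).
rewrite -[X in X - _]/(((d - i) * i.+1)%N%:Z%:~R).
rewrite -[X in _ - X]/((i * (d - i.-1))%N%:Z%:~R) -intrB; congr (_%:~R).
(* The identity is $(d-i)(i+1)-i(d-i+1)=d-2i$. *)
by have := ltn_ord i; case: (nat_of_ord i) => [|j]; nia.
Qed.

Lemma weigh_raise_basis i : E (raise v i) - X (weigh v i) = 2 *: raise v i.
Proof.
rewrite (linearZ_LR E) (linearZ_LR X) Xv Ev /raise /weigh !scalerA.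
rewrite -scalerBl; case: (posnP i) => [->|i_gt0].
  by rewrite !(mul0r, mulr0) subrr.
congr (_ *: _).
have lt_id : (i.-1 < d.+1)%N by rewrite (leq_ltn_trans (leq_pred _)).
rewrite inordK // -[(i : nat)%:R]/((i : nat)%:Z%:~R) -[2 in RHS]/(2%:~R).
rewrite -!intrM -intrB; congr (_%:~R); nia.
Qed.

Lemma weigh_lower_basis i : E (lower v i) - Y (weigh v i) = - 2 *: lower v i.
Proof.
rewrite (linearZ_LR E) (linearZ_LR Y) Yv Ev /lower /weigh !scalerA.
rewrite -scalerBl; have [lt_id|] := ltnP i d; last first.
  by rewrite -subn_eq0 => /eqP ->; rewrite !(mul0r, mulr0) subrr.
congr (_ *: _).
rewrite inordK // -[(d - i)%:R]/((d - i)%N%:Z%:~R) -[- 2 in RHS]/((-2)%:~R).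
rewrite -!intrM -intrB; congr (_%:~R); nia.
Qed.
End OneBlock.

Lemma DE_basis1 i : DE (basis1 i) = weigh basis1 i.
Proof. by rewrite /DE derivation_ofX /on_basis (unsplitK (inl i)). Qed.

Lemma DE_basis2 j : DE (basis2 j) = weigh basis2 j.
Proof. by rewrite /DE derivation_ofX /on_basis (unsplitK (inr j)). Qed.

Lemma D1_D2 p : D1 (D2 p) - D2 (D1 p) = DE p.
Proof.
apply: derivation_of_commutator => k; rewrite /on_basis; case: split => i.
- exact: (@raise_lower_basis _ basis1 D1 D2 D1_basis1 D2_basis1).
- exact: (@raise_lower_basis _ basis2 D1 D2 D1_basis2 D2_basis2).
Qed.

Lemma DE_D1 p : DE (D1 p) - D1 (DE p) = 2 *: D1 p.
Proof.
rewrite -derivation_ofZ; apply: derivation_of_commutator => k.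
rewrite /on_basis; case: split => i.
- exact: (@weigh_raise_basis _ basis1 D1 DE D1_basis1 DE_basis1).
- exact: (@weigh_raise_basis _ basis2 D1 DE D1_basis2 DE_basis2).
Qed.

Lemma DE_D2 p : DE (D2 p) - D2 (DE p) = - 2 *: D2 p.
Proof.
rewrite -derivation_ofZ; apply: derivation_of_commutator => k.
rewrite /on_basis; case: split => i.
- exact: (@weigh_lower_basis _ basis1 D2 DE D2_basis1 DE_basis1).
- exact: (@weigh_lower_basis _ basis2 D2 DE D2_basis2 DE_basis2).
Qed.

Lemma DE_homog n p : p \is n.-homog -> DE p \is n.-homog.
Proof.
by apply/derivation_of_homog/on_basis_homog => i;
  apply: rpredZ; rewrite dhomogX /= mdeg1.
Qed.

Definition mnm_weight (m : 'X_{1..nvars d1 d2}) : int :=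
  \sum_(i < d1.+1) (d1%:Z - 2 * i%:Z) * (m (lshift _ i))%:Z
  + \sum_(j < d2.+1) (d2%:Z - 2 * j%:Z) * (m (rshift _ j))%:Z.

(** [DE] is a weighted sum of Euler operators $x_k\partial_k$, each multiplying the monomial by its
    exponent of $x_k$. *)
Lemma DE_monomial m : DE 'X_[m] = (mnm_weight m)%:~R *: 'X_[m].
Proof.
have dX (a : C) k : a *: 'X_k * ('X_[m])^`M(k) = (a * (m k)%:R) *: 'X_[m] :> S.
  rewrite mderivX -scalerAl -scalerAr scalerA.
  have [->|mk0] := eqVneq (m k) 0%N; first by rewrite mulr0 !scale0r.
  rewrite -mpolyXD addmC submK //.
  by apply/mnm_lepP => l; rewrite mnmE; case: eqP => // <-; rewrite lt0n.
rewrite /DE /derivation_of big_split_ord /= intrD scalerDl.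
rewrite !(raddf_sum _, scaler_suml) /=.
congr (_ + _); apply: eq_bigr => i _.
- by rewrite /on_basis (unsplitK (inl i)) dX intrM.
- by rewrite /on_basis (unsplitK (inr i)) dX intrM.
Qed.

Lemma mcoeff_DE p m : (DE p)@_m = (mnm_weight m)%:~R * p@_m.
Proof.
elim/mpolyind: p => [|a m' p _ _ IHp]; first by rewrite /DE linear0 mcoeff0 mulr0.
rewrite [DE _]derivation_of_is_linear -/(DE _) -/(DE _) !mcoeffD.
rewrite DE_monomial !mcoeffZ IHp mcoeffX.
by case: eqVneq => [->|_]; rewrite ?mulr0 ?add0r ?mulrDr // mulrCA.
Qed.
End DerivationIdentities.

(** * Solutions counted by [omega] as exponents of monomials *)

Section OmegaMonomials.
Context (n d1 d2 : nat).
Local Notation AB := ({ffun 'I_d1.+1 -> 'I_n.+1} * {ffun 'I_d2.+1 -> 'I_n.+1})%type.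

Definition exponents (ab : AB) : 'X_{1..nvars d1 d2} :=
  [multinom match split k with inl i => ab.1 i : nat | inr j => ab.2 j : nat end
    | k < nvars d1 d2].

Lemma exponents_lshift ab i : exponents ab (lshift _ i) = ab.1 i.
Proof. by rewrite mnmE (unsplitK (inl i)). Qed.

Lemma exponents_rshift ab j : exponents ab (rshift _ j) = ab.2 j.
Proof. by rewrite mnmE (unsplitK (inr j)). Qed.

Lemma exponents_inj : injective exponents.
Proof.
move=> [a b] [a' b'] /mnmP eq_exp; congr pair; apply/ffunP => i; apply/val_inj.
  by have := eq_exp (lshift _ i); rewrite !exponents_lshift.
by have := eq_exp (rshift _ i); rewrite !exponents_rshift.
Qed.

Lemma exponents_surj m : mdeg m = n -> exists ab, m = exponents ab.
Proof.
(* Each exponent is at most the total degree, so it fits in ['I_n.+1]. *)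
move=> deg_m; have ltm k : (m k < n.+1)%N.
  by rewrite ltnS -deg_m mdegE (bigD1 k) ?leq_addr.
exists ([ffun i => inord (m (lshift _ i))], [ffun j => inord (m (rshift _ j))]).
apply/mnmP => k; rewrite mnmE -{1}(splitK k).
by case: split => i; rewrite /= ffunE inordK.
Qed.

Lemma omega_sol_exponents i (ab : AB) :
  omega_sol n i (fun j => ab.1 j) (fun j => ab.2 j)
  = (mnm_weight (exponents ab) == i) && (mdeg (exponents ab) == n).
Proof.
have wE d (a : 'I_d.+1 -> nat) :
    \sum_(j < d.+1) (d%:Z - 2 * j%:Z) * (a j)%:Z
    = (d * \sum_j a j)%N%:Z - (\sum_(j < d.+1) j * a j)%N%:Z * 2.
  elim/big_ind3: _ => [|x1 x2 x3 y1 y2 y3 -> ->|j _]; rewrite ?muln0 //; lia.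
have -> : mdeg (exponents ab) = (\sum_j ab.1 j + \sum_j ab.2 j)%N.
  rewrite mdegE big_split_ord /=; congr addn; apply: eq_bigr => j _.
    by rewrite exponents_lshift.
  by rewrite exponents_rshift.
rewrite /mnm_weight.
under [X in _ && _ = (X + _ == _) && _]eq_bigr do rewrite exponents_lshift.
under [X in _ && _ = (_ + X == _) && _]eq_bigr do rewrite exponents_rshift.
rewrite !wE /omega_sol; congr (_ && _); congr (_ == _); ring.
Qed.

Definition deg_exponents := {ab : AB | mdeg (exponents ab) == n}.

(** The degree equation is absorbed into the index type, leaving the weight as the only
    condition. *)
Lemma omegaE (i : int) :
  omega n d1 d2 i = #|[pred x : deg_exponents | mnm_weight (exponents (val x)) == i]|.
Proof.
rewrite -(card_image val_inj); apply: eq_card => ab.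
rewrite inE omega_sol_exponents; apply/andP/imageP => [[wt_ab deg_ab]|[x wt_x ->]].
  by exists (Sub ab deg_ab); rewrite ?inE.
by split; [rewrite inE in wt_x | exact: valP x].
Qed.
End OmegaMonomials.

(** * The monomial basis of the degree-[n] component and the operators on it *)

Section HomogeneousBasis.
Context (R : realType) (d1 d2 n : nat).
Local Notation Sn := (dhomog (nvars d1 d2) R[i] n).
Local Notation I := (deg_exponents n d1 d2).

Definition monomial_coef (x : I) (p : Sn) : R[i] := (val p)@_(exponents (val x)).

Lemma monomial_coef_is_linear x : linear_for *%R (monomial_coef x).
Proof. by move=> a p q; apply: etrans (mcoeffD _ _ _) _; rewrite mcoeffZ. Qed.

HB.instance Definition _ x :=
  GRing.isLinear.Build _ _ _ _ (monomial_coef x) (monomial_coef_is_linear x).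

Lemma monomial_homog (x : I) : ('X_[exponents (val x)] : {mpoly R[i][_]}) \is n.-homog.
Proof. by rewrite dhomogX (valP x). Qed.

Definition monomial (x : I) : Sn := DHomog (monomial_homog x).

Lemma monomial_coefE x y : monomial_coef x (monomial y) = (x == y)%:R.
Proof.
by rewrite /monomial_coef mcoeffX (inj_eq (@exponents_inj _ _ _)) (inj_eq val_inj) eq_sym.
Qed.

Lemma monomial_expansion p : p = \sum_x monomial_coef x p *: monomial x.
Proof.
apply/val_inj/mpolyP => m; rewrite linear_sum raddf_sum /=.
have [deg_m|deg_m] := eqVneq (mdeg m) n.
  have [ab def_m] := exponents_surj deg_m.
  have deg_ab : mdeg (exponents ab) == n by rewrite -def_m deg_m.
  rewrite (bigD1 (Sub ab deg_ab)) //= big1 => [|x neq_x].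
    by rewrite addr0 mcoeffZ mcoeffX def_m eqxx mulr1.
  rewrite mcoeffZ mcoeffX def_m (inj_eq (@exponents_inj _ _ _)).
  by rewrite -[ab]/(val (Sub ab deg_ab : I)) (inj_eq val_inj) (negPf neq_x) mulr0.
(* Away from degree [n] the coefficients on both sides are 0. *)
rewrite (dhomog_nemf_coeff (dhomog_is_dhomog p) deg_m) big1 // => x _.
rewrite mcoeffZ mcoeffX; case: eqVneq => [def_m|]; last by rewrite mulr0.
by rewrite -def_m (valP x) in deg_m.
Qed.

Definition DEn (p : Sn) : Sn := DHomog (DE_homog (dhomog_is_dhomog p)).

Lemma DEn_is_linear : linear DEn.
Proof. by move=> c p q; apply/val_inj; apply: derivation_of_is_linear. Qed.

HB.instance Definition _ := GRing.isLinear.Build _ _ _ _ DEn DEn_is_linear.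

Lemma monomial_coef_DEn x p :
  monomial_coef x (DEn p) = (mnm_weight (exponents (val x)))%:~R * monomial_coef x p.
Proof. exact: mcoeff_DE. Qed.

Lemma D1n_D2n (p : Sn) : D1n (D2n p) - D2n (D1n p) = DEn p.
Proof. by apply/val_inj; apply: D1_D2. Qed.

Lemma DEn_D1n (p : Sn) : DEn (D1n p) - D1n (DEn p) = 2 *: D1n p.
Proof. by apply/val_inj; apply: DE_D1. Qed.

Lemma DEn_D2n (p : Sn) : DEn (D2n p) - D2n (DEn p) = - 2 *: D2n p.
Proof. by apply/val_inj; apply: DE_D2. Qed.
End HomogeneousBasis.

Theorem theorem1 (R : realType) (d1 d2 : nat)
    (hd1 : (0 < d1)%N) (hd2 : (0 < d2)%N) (n : nat) :
  ((\dim (joint_invariants_deg R d1 d2 n))%:Z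
     = (omega n d1 d2 0)%:Z - (omega n d1 d2 2)%:Z)
  /\ (\dim (joint_semi_invariants_deg R d1 d2 n)
     = omega n d1 d2 0 + omega n d1 d2 1)%N.
Proof.
have [inv semi] := dim_invariant_highest_weight
  (@monomial_coefE R d1 d2 n) (@monomial_expansion R d1 d2 n)
  (@monomial_coef_DEn R d1 d2 n) (@D1n_D2n R d1 d2 n) (@DEn_D1n R d1 d2 n)
  (@DEn_D2n R d1 d2 n).
rewrite !omegaE; split; last exact: semi.
(* The integer difference is moved back to the additive equality of naturals given by [inv]. *)
apply/eqP; rewrite eq_sym subr_eq -PoszD eqz_nat eq_sym; apply/eqP; exact: inv.
Qed.
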